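(* Let $M,N\ge 1$ and $p,r\ge 1$ be integers, and let $c_p^r=\mathrm{Tr}(T_p^r)$ be the truncated moments of the deformed Fourier model defined in the context. Then $$c_p^r=\frac{1}{M^{r+1}N}\,\#\Big\{(i,a,b)\in\mathbb Z_M^r\times\mathbb Z_M^p\times\mathbb Z_N^p\ :\ \text{condition }(E_x)\text{ holds for every }x=1,\dots,r\Big\},$$ where $(E_x)$ is the condition that the two multisets (of $2p$ elements of $\mathbb Z_M\times\mathbb Z_N$, counted with multiplicity) $$\big\{(i_x+a_y,b_y),\ (i_{x+1}+a_y,b_{y+1})\ :\ y=1,\dots,p\big\}\quad\text{and}\quad\big\{(i_x+a_y,b_{y+1}),\ (i_{x+1}+a_y,b_y)\ :\ y=1,\dots,p\big\}$$ coincide, with cyclic conventions $i_{r+1}=i_1$, $b_{p+1}=b_1$, and addition taken in $\mathbb Z_M$.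
   Context: Let $w_M=e^{2\pi\sqrt{-1}/M}$, $w_N=e^{2\pi\sqrt{-1}/N}$, $I=\mathbb Z_M\times\mathbb Z_N$, $K=MN$. For $Q=(Q_{ib})_{i\in\mathbb Z_M,b\in\mathbb Z_N}\in\mathbb T^{MN}$ define the matrix $H(Q)\in M_I(\mathbb C)$ by $H(Q)_{(i,a),(j,b)}=Q_{ib}\,w_M^{ij}\,w_N^{ab}$ (a complex Hadamard matrix). Write $H_\alpha(Q)\in\mathbb T^{I}$ for its row indexed by $\alpha\in I$. For $\alpha,\beta\in I$ let $\xi=H_\alpha(Q)/H_\beta(Q)$ (entrywise quotient) and let $U_{\alpha\beta}(Q)=\frac1K\xi\xi^*\in M_I(\mathbb C)$ be the orthogonal projection onto $\mathbb C\xi$. Let $dQ$ be the normalized Haar measure on $\mathbb T^{MN}$. Define the matrix $T_p$ indexed by $I^p\times I^p$ by $(T_p)_{\alpha_1\ldots\alpha_p,\beta_1\ldots\beta_p}=\int_{\mathbb T^{MN}}\frac1K\mathrm{Tr}\big(U_{\alpha_1\beta_1}(Q)\cdots U_{\alpha_p\beta_p}(Q)\big)\,dQ$, and set $c_p^r=\mathrm{Tr}(T_p^r)$, where $\mathrm{Tr}$ denotes the usual (unnormalized) matrix trace. *)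

(* Defs.v *)
From Stdlib Require Import Reals.
From mathcomp Require Import all_boot.
Set Implicit Arguments. Unset Strict Implicit. Unset Printing Implicit Defensive.

Notation C := (prod R R).
Definition C0 : C := (R0, R0).
Definition C1 : C := (R1, R0).
Definition CofR (x : R) : C := (x, R0).
Definition Cadd (z w : C) : C := (Rplus z.1 w.1, Rplus z.2 w.2).
Definition Cmul (z w : C) : C :=
  (Rminus (Rmult z.1 w.1) (Rmult z.2 w.2), Rplus (Rmult z.1 w.2) (Rmult z.2 w.1)).
Definition Cconj (z : C) : C := (z.1, Ropp z.2).
Definition Re (z : C) : R := z.1.
Definition Im (z : C) : R := z.2.
Definition Cexp2pi (t : R) : C := (cos (Rmult (Rmult 2 PI) t), sin (Rmult (Rmult 2 PI) t)).

Section CMat.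
Variable J : finType.
Definition cmat := J -> J -> C.
Definition cmat1 : cmat := fun j k => if j == k then C1 else C0.
Definition cmatmul (A B : cmat) : cmat :=
  fun j k => \big[Cadd/C0]_(l : J) Cmul (A j l) (B l k).
Definition cmatpow (A : cmat) (n : nat) : cmat := iter n (fun X => cmatmul X A) cmat1.
Definition ctrace (A : cmat) : C := \big[Cadd/C0]_(j : J) A j j.
Definition cmatprod (s : seq cmat) : cmat := foldr cmatmul cmat1 s.
End CMat.

(* iter_int vs f v : the iterated integral over the variables vs (each over
   [0,1], Lebesgue = Riemann here) of f exists and equals v.
   The remaining variables are set to 0 once every variable of vs is bound. *)
Section IterInt.
Variable V : eqType.
Definition upd (th : V -> R) (k : V) (t : R) : V -> R :=
  fun j => if j == k then t else th j.
Fixpoint iter_int_from (th : V -> R) (vs : seq V) (f : (V -> R) -> R) (v : R) : Prop :=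
  match vs with
  | [::] => v = f th
  | k :: vs' =>
      exists g : R -> R,
        (forall t : R, iter_int_from (upd th k t) vs' f (g t)) /\
        exists pr : Riemann_integrable g R0 R1, RiemannInt pr = v
  end.
End IterInt.

(* Integral of f : T^{V} -> C against normalized Haar measure dQ, in the
   angle parametrisation Q_k = e^{2 pi sqrt(-1) theta_k}, theta in [0,1]^V;
   the integrand is given as a function of the angles. *)
Definition haar_int (V : finType) (f : (V -> R) -> C) (z : C) : Prop :=
  iter_int_from (fun _ => R0) (enum V) (fun th => Re (f th)) (Re z) /\
  iter_int_from (fun _ => R0) (enum V) (fun th => Im (f th)) (Im z).

Section Model.
Variables M N : nat.
Definition Idx : finType := ('I_M * 'I_N)%type.

Definition Qent (th : Idx -> R) (i : 'I_M) (b : 'I_N) : C := Cexp2pi (th (i, b)).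

Definition wpow (n m k : nat) : C := Cexp2pi (Rdiv (INR (m * k)) (INR n)).

Definition Hmat (th : Idx -> R) : cmat Idx :=
  fun al ga => Cmul (Qent th al.1 ga.2) (Cmul (wpow M al.1 ga.1) (wpow N al.2 ga.2)).

Definition Kdim : R := Rmult (INR M) (INR N).

Definition Cinv (z : C) : C :=
  let n := Rplus (Rmult z.1 z.1) (Rmult z.2 z.2) in (Rdiv z.1 n, Rdiv (Ropp z.2) n).
Definition xi (th : Idx -> R) (al be : Idx) (ga : Idx) : C :=
  Cmul (Hmat th al ga) (Cinv (Hmat th be ga)).

Definition Umat (th : Idx -> R) (al be : Idx) : cmat Idx :=
  fun ga de => Cmul (CofR (Rinv Kdim)) (Cmul (xi th al be ga) (Cconj (xi th al be de))).

Variable p : nat.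
Definition Tidx : finType := {ffun 'I_p -> Idx}.

Definition Tintegrand (al be : Tidx) (th : Idx -> R) : C :=
  Cmul (CofR (Rinv Kdim))
       (ctrace (cmatprod [seq Umat th (al y) (be y) | y <- enum 'I_p])).

Definition is_Tp (T : cmat Tidx) : Prop :=
  forall al be : Tidx, haar_int (Tintegrand al be) (T al be).

Definition addZ (n : nat) (x y : 'I_n) : 'I_n :=
  Ordinal (ltn_pmod (x + y) (leq_ltn_trans (leq0n x) (ltn_ord x))).

Definition cond_E (r : nat) (i : {ffun 'I_r -> 'I_M}) (a : {ffun 'I_p -> 'I_M})
    (b : {ffun 'I_p -> 'I_N}) (x : 'I_r) : bool :=
  perm_eq
    (flatten [seq [:: (addZ (i x) (a y), b y); (addZ (i (ordS x)) (a y), b (ordS y))]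
             | y <- enum 'I_p])
    (flatten [seq [:: (addZ (i x) (a y), b (ordS y)); (addZ (i (ordS x)) (a y), b y)]
             | y <- enum 'I_p]).

Definition count_E (r : nat) : nat :=
  #|[set t : {ffun 'I_r -> 'I_M} * {ffun 'I_p -> 'I_M} * {ffun 'I_p -> 'I_N}
       | [forall x : 'I_r, cond_E t.1.1 t.1.2 t.2 x]]|.
End Model.

(* Main.v *)
Require Import Defs.
From Stdlib Require Import Reals Lra FunctionalExtensionality.
From mathcomp Require Import all_boot all_algebra.
From mathcomp Require Import complex Rstruct.
From Coquelicot Require Import Rcomplements Hierarchy RInt RInt_analysis Continuity Derive AutoDerive.
Set Implicit Arguments. Unset Strict Implicit. Unset Printing Implicit Defensive.
Import GRing.Theory.
Delimit Scope R_scope with coqR.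

(* Expanding the traces, an entry of T_p is a sum over closed paths ga in I^p of
   a root of unity times the Haar integral of a monomial in Q, which is 1 when
   the two multisets of indices of numerator and denominator agree and 0
   otherwise.  Summing over the Z_M-components of ga forces the differences
   i_y - j_y of the row indices to be constant in y, and, in Tr(T_p^r), summing
   over the Z_N-components a^x_y of the row indices forces c^x_y - c^x_(y+1) to
   be constant in x.  Hence both surviving families are grids: i^x_y = i_x + a_y
   and c^x_y = d_x + b_y, such a representation being unique up to M (resp. N)
   choices, while the balance of the multisets does not depend on d. *)

(** * Complex exponentials and roots of unity *)

Section Analysis.
Local Open Scope ring_scope.

(** Carries pairs of reals into a field structure where big sums and primitive roots are available.
    It is injective, so identities proved in [R[i]] can be pulled back. *)
Definition toF (z : R * R) : R[i] := Complex z.1 z.2.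
Definition e (t : R) : R[i] := toF (Cexp2pi t).
Arguments e t%_ring_scope.

Lemma toF_inj : injective toF.
Proof. by move=> [a b] [c d] [-> ->]. Qed.

Lemma toF_mul z w : toF (Cmul z w) = toF z * toF w.
Proof. by []. Qed.

Lemma toF_sum (I : finType) (f : I -> (R * R)%type) :
  toF (\big[Cadd/C0]_i f i) = \sum_i toF (f i).
Proof. by apply: (big_morph toF). Qed.

Lemma toF_nat_inv n : toF (CofR (Rinv (INR n))) = n%:R^-1.
Proof.
rewrite /toF /CofR /= RinvE INRE -(rmorph_nat (real_complex R)) -fmorphV.
by [].
Qed.

Lemma eD s t : e (s + t) = e s * e t.
Proof.
rewrite /e -toF_mul /Cexp2pi /Cmul /= -RplusE Rmult_plus_distr_l cos_plus sin_plus.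
by congr (toF (_, _)); rewrite Rplus_comm.
Qed.

Lemma e0 : e 0 = 1.
Proof. by rewrite /e /Cexp2pi Rmult_0_r cos_0 sin_0. Qed.

Lemma e_neq0 t : e t != 0.
Proof.
apply/eqP => h; have := e0; rewrite -(subrr t) eD h mul0r => /eqP.
by rewrite eq_sym oner_eq0.
Qed.

Lemma eN t : e (- t) = (e t)^-1.
Proof. by apply: (mulfI (e_neq0 t)); rewrite -eD subrr e0 divff ?e_neq0. Qed.

Lemma e_sum (I : Type) (s : seq I) (P : pred I) (f : I -> R) :
  e (\sum_(i <- s | P i) f i) = \prod_(i <- s | P i) e (f i).
Proof. by apply: (big_morph e eD e0). Qed.

Lemma e1 : e 1 = 1.
Proof. by rewrite /e /Cexp2pi Rmult_1_r cos_2PI sin_2PI. Qed.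

Lemma eMn t n : e (t *+ n) = e t ^+ n.
Proof. by elim: n => [|n IH]; rewrite ?mulr0n ?e0 // mulrS eD IH exprS. Qed.

Lemma e_int (n : int) : e n%:~R = 1.
Proof.
case: n => n; first by rewrite -pmulrn eMn e1 expr1n.
by rewrite NegzE rmorphN eN /= -pmulrn eMn e1 expr1n invr1.
Qed.

Lemma toF_conj_e t : toF (Cconj (Cexp2pi t)) = e (- t).
Proof.
rewrite /e /Cexp2pi /Cconj /= -RoppE.
by rewrite Ropp_mult_distr_r_reverse cos_neg sin_neg.
Qed.

(** The real part is 1 - 2 sin(pi t)^2, and sin(pi t) > 0 on the open interval. *)
Lemma e_lt1_neq1 t : (0 < t < 1)%coqR -> e t <> 1.
Proof.
move=> [t0 t1] [h _].
have hs : (0 < sin (PI * t))%coqR.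
  have hP := PI_RGT_0.
  by apply: sin_gt_0; nra.
move: h; rewrite /= Rmult_assoc cos_2a_sin -R1E; nra.
Qed.

Lemma prim_root_e n : (0 < n)%N -> n.-primitive_root (e (1 / INR n)).
Proof.
move=> n0; rewrite /primitive_root_of_unity n0 /=; apply/forallP => i.
have nn0 : INR n <> 0%coqR by apply: not_0_INR; case: n n0 i.
rewrite unity_rootE -eMn; apply/eqP; apply/eqP/eqP; last first.
  move=> ->; rewrite -mulr_natr -INRE -RdivE -RmultE.
  have ->: (1 / INR n * INR n)%coqR = 1%coqR by field.
  exact: e1.
(* For an exponent i+1 < n the angle (i+1)/n lies strictly between 0 and 1, where [e] avoids 1. *)
have := ltn_ord i; rewrite leq_eqVlt => /orP [/eqP // | lt_in].
move=> h; exfalso; move: h; apply: e_lt1_neq1.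
rewrite -mulr_natr -INRE -RdivE -RmultE.
have hn : (0 < INR n)%coqR by apply: lt_0_INR; apply/ltP.
have hi : (0 < INR i.+1)%coqR by apply: lt_0_INR; apply/ltP.
have hin : (INR i.+1 < INR n)%coqR by apply: lt_INR; apply/ltP.
have ->: (1 / INR n * INR i.+1)%coqR = (INR i.+1 / INR n)%coqR by field.
split; first by apply: Rdiv_lt_0_compat.
by apply/Rlt_div_l => //; lra.
Qed.

End Analysis.
Arguments e t%_ring_scope.

(** * Haar integrals of trigonometric polynomials *)

Section Integration.
Local Open Scope ring_scope.

(** Orthogonality of characters in one variable: for nonzero [m] an antiderivative is 1-periodic, so
    the integral over a period vanishes. *)
Lemma is_RInt_e (c : R[i]) (m : int) (s : R) :
  is_RInt (fun t : R => complex.Re (c * e (m%:~R * t + s))) R0 R1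
    (if m == 0 then complex.Re (c * e s) else 0).
Proof.
case: eqVneq => [->|m0].
  have := is_RInt_const R0 R1 (complex.Re (c * e s)).
  rewrite /scal /= /mult /= Rminus_0_r Rmult_1_l; apply: is_RInt_ext => t _.
  by rewrite mulr0z mul0r add0r.
case: c => c1 c2; pose mr : R := m%:~R.
have mr0 : mr <> 0%coqR by apply/eqP; rewrite /mr R0E intr_eq0.
have hpi : PI <> 0%coqR by have := PI_RGT_0; lra.
(* Differentiating the exponential multiplies it by 2 pi m sqrt(-1), which turns the imaginary part
   into the real one. *)
pose G t := (/ (2 * PI * mr) * complex.Im (Complex c1 c2 * e (mr * t + s))%R)%coqR.
have per : G R1 = G R0.
  rewrite /G; congr (_ * complex.Im (_ * _)%R)%coqR.
  rewrite (_ : R0 = 0%R) // (_ : R1 = 1%R) // mulr1 mulr0 add0r eD /mr e_int mul1r //.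
have -> : 0%R = minus (G R1) (G R0).
  by rewrite per /minus plus_opp_r.
apply: is_RInt_derive => t _.
  change (is_derive (fun t : R => / (2 * PI * mr) *
    (c1 * sin (2 * PI * (mr * t + s)) + c2 * cos (2 * PI * (mr * t + s)))) t
    (c1 * cos (2 * PI * (mr * t + s)) - c2 * sin (2 * PI * (mr * t + s))))%coqR.
  by auto_derive => //; field.
apply: ex_derive_continuous.
change (ex_derive (fun t : R =>
  c1 * cos (2 * PI * (mr * t + s)) - c2 * sin (2 * PI * (mr * t + s)))%coqR t).
by auto_derive.
Qed.

Lemma is_RInt_sum (S : Type) (s : seq S) (P : pred S) (f : S -> R -> R) (v : S -> R) :
  (forall i, is_RInt (f i) R0 R1 (v i)) ->
  is_RInt (fun t => \sum_(i <- s | P i) f i t) R0 R1 (\sum_(i <- s | P i) v i).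
Proof.
move=> h; elim: s => [|i s IH].
  rewrite big_nil.
  have := is_RInt_const R0 R1 R0.
  rewrite /scal /= /mult /= Rmult_0_r; apply: is_RInt_ext => t _.
  by rewrite big_nil.
rewrite big_cons; case: ifP => hP.
  apply: is_RInt_ext (is_RInt_plus _ _ _ _ _ _ (h i) IH) => t _.
  by rewrite big_cons hP.
by apply: is_RInt_ext IH => t _; rewrite big_cons hP.
Qed.

(** By induction the inner integrals agree pointwise, and Riemann integrals of such functions agree
    whatever their integrability proofs. This identifies a value given by [haar_int] with a computed
    one. *)
Lemma iter_int_from_unique (V : eqType) (f g : (V -> R) -> R) :
  f =1 g -> forall vs th v w,
  iter_int_from th vs f v -> iter_int_from th vs g w -> v = w.
Proof.
move=> fg; elim=> [|k vs IH] th v w /=; first by move=> -> ->; rewrite fg.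
move=> [g1 [h1 [pr1 <-]]] [g2 [h2 [pr2 <-]]].
apply: RiemannInt_P18 => [|t _]; first by apply: Rlt_le; exact: Rlt_0_1.
exact: IH (h1 t) (h2 t).
Qed.

(** The Laurent monomial in the Q_k with exponents [n k], written in the angles. *)
Definition trig_mono (V : finType) (n : V -> int) (th : V -> R) : R[i] :=
  e (\sum_k (n k)%:~R * th k).

Lemma trig_mono_upd (V : finType) (n : V -> int) th k t :
  trig_mono n (upd th k t) =
  e ((n k)%:~R * t + \sum_(j | j != k) (n j)%:~R * th j).
Proof.
rewrite /trig_mono (bigD1 k) //= /upd eqxx; congr (e (_ + _)).
by apply: eq_bigr => j /negPf ->.
Qed.

(** Each integrated variable discards the terms in which its exponent is nonzero and leaves the
    others unchanged. Keeping [th] general lets the induction pass under [upd]. *)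
Lemma iter_int_trig_poly (V S : finType) (n : S -> V -> int) (W : S -> R[i]) vs th :
  iter_int_from th vs (fun th => complex.Re (\sum_s W s * trig_mono (n s) th))
   (complex.Re (\sum_(s | all (fun k => n s k == 0) vs) W s * trig_mono (n s) th)).
Proof.
elim: vs th => [|k vs IH] th //=.
(* The inner value is the one of the induction hypothesis, with the angle of [k] frozen at [t]. *)
exists (fun t => complex.Re (\sum_(s | all (fun k => n s k == 0) vs)
          W s * trig_mono (n s) (upd th k t))).
split; first by move=> t; exact: IH.
set g := (fun t => _).
set v := complex.Re _.
have hI : is_RInt g R0 R1 v.
  pose r s := \sum_(j | j != k) (n s j)%:~R * th j.
  have := @is_RInt_sum S (index_enum S) (fun s => all (fun k => n s k == 0) vs) _ _
    (fun s => @is_RInt_e (W s) (n s k) (r s)).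
  set w := \sum_(_ <- _ | _) _.
  have -> : w = v.
    rewrite /v raddf_sum /= big_mkcondl; apply: eq_bigr => s _.
    case: eqP => // h0.
    by rewrite /trig_mono (bigD1 k) //= h0 mul0r add0r.
  apply: is_RInt_ext => t _.
  by rewrite /g raddf_sum; apply: eq_bigr => s _; rewrite trig_mono_upd.
have pr : Riemann_integrable g R0 R1.
  by apply: ex_RInt_Reals_0; exists v.
by exists pr; rewrite -RInt_Reals; apply: is_RInt_unique.
Qed.

Lemma haar_int_trig_poly (V S : finType) (n : S -> V -> int) (W : S -> R[i])
    (f : (V -> R) -> R * R) (z : R * R) :
  (forall th, toF (f th) = \sum_s W s * trig_mono (n s) th) ->
  haar_int f z ->
  toF z = \sum_(s | [forall k, n s k == 0]) W s.
Proof.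
move=> hf [hre him].
(* [iter_int_from] is started at angle 0 everywhere, where each monomial equals 1. *)
have E : \sum_(s | [forall k, n s k == 0]) W s =
   \sum_(s | all (fun k => n s k == 0) (enum V)) W s * trig_mono (n s) (fun=> 0).
  apply: eq_big => [s|s _].
    by apply/forallP/allP => h k; rewrite ?h ?mem_enum //; apply: h; rewrite mem_enum.
  by rewrite /trig_mono big1 ?e0 ?mulr1 // => k _; rewrite mulr0.
have rE : z.1 = complex.Re (\sum_(s | [forall k, n s k == 0]) W s).
  rewrite E; apply: iter_int_from_unique hre (iter_int_trig_poly _ _ _ _) => th.
  by rewrite -hf.
have iE : z.2 = complex.Im (\sum_(s | [forall k, n s k == 0]) W s).
  (* Multiplying all weights by -sqrt(-1) reduces the imaginary part to the computation for real
     parts. *)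
  have ReMNi x : complex.Re (Complex 0 (-1) * x) = complex.Im x.
    by case: x => a b /=; rewrite mul0r mulN1r sub0r opprK.
  rewrite -ReMNi mulr_sumr.
  have -> : \sum_(s | [forall k, n s k == 0]) Complex 0 (-1) * W s =
    \sum_(s | all (fun k => n s k == 0) (enum V))
       (Complex 0 (-1) * W s) * trig_mono (n s) (fun=> 0).
    by rewrite -mulr_sumr E mulr_sumr; apply: eq_bigr => s _; rewrite mulrA.
  apply: iter_int_from_unique him (iter_int_trig_poly _ _ _ _) => th.
  rewrite -(eq_bigr _ (fun s _ => mulrA _ _ _)) -mulr_sumr ReMNi -hf //.
by rewrite /toF rE iE; case: (\sum_(_ | _) _).
Qed.

End Integration.

(** * Finite functions on ordinals, split at their first value *)

Section Algebra.
Local Open Scope ring_scope.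

Definition fcons (J : Type) n (j : J) (f : {ffun 'I_n -> J}) : {ffun 'I_n.+1 -> J} :=
  [ffun y => if unlift ord0 y is Some y' then f y' else j].

Lemma fcons0 (J : Type) n (j : J) (f : {ffun 'I_n -> J}) (y : 'I_n.+1) :
  y = 0%N :> nat -> fcons j f y = j.
Proof.
by move=> y0; rewrite ffunE (_ : y = ord0) ?unlift_none //; apply: val_inj.
Qed.

Lemma fconsS (J : Type) n (j : J) (f : {ffun 'I_n -> J}) (y : 'I_n.+1) (z : 'I_n) :
  y = z.+1 :> nat -> fcons j f y = f z.
Proof.
by move=> yz; rewrite ffunE (_ : y = lift ord0 z) ?liftK //; apply: val_inj.
Qed.

Lemma sum_ffunS (V : nmodType) (J : finType) n (F : {ffun 'I_n.+1 -> J} -> V) :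
  \sum_f F f = \sum_j \sum_f F (fcons j f).
Proof.
rewrite pair_big /= (reindex (fun u : J * {ffun 'I_n -> J} => fcons u.1 u.2)) //=.
exists (fun f => (f ord0, [ffun y => f (lift ord0 y)])) => [[j f] _ | f _] /=.
  by congr pair; [rewrite fcons0 | apply/ffunP => y; rewrite ffunE (fconsS _ _ (z := y))].
apply/ffunP => y; case: (unliftP ord0 y) => [z|] ->.
  by rewrite (fconsS _ _ (z := z)) // ffunE.
by rewrite fcons0.
Qed.

(** * Matrix products and traces as sums over paths *)

Section MatrixProduct.
Variables (F : comNzRingType) (J : finType).
Implicit Types (A B : J -> J -> F).

Definition fmul A B (j k : J) := \sum_l A j l * B l k.
Definition fone (j k : J) : F := (j == k)%:R.

(** Associativity of the product. It reconciles [foldr], which adds factors on the left, with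
    [cmatpow], which adds them on the right. *)
Lemma foldr_fmul_rcons s A j k :
  foldr fmul fone (rcons s A) j k = fmul (foldr fmul fone s) A j k.
Proof.
elim: s j k => [|B s IH] j k /=; rewrite /fmul.
  rewrite (bigD1 k) //= [X in _ + X]big1 ?addr0 => [|l /negPf lk]; last first.
    by rewrite /fone lk mulr0.
  rewrite [RHS](bigD1 j) //= [X in _ = _ + X]big1 ?addr0 => [|l /negPf lj]; last first.
    by rewrite /fone eq_sym lj mul0r.
  by rewrite /fone !eqxx mulr1 mul1r.
under eq_bigr => l _ do rewrite IH /fmul mulr_sumr.
rewrite exchange_big /=; apply: eq_bigr => l _.
by rewrite mulr_suml; apply: eq_bigr => l' _; rewrite mulrA.
Qed.

(** A product of [n] matrices sums over paths with [n.+1] vertices and prescribed ends; the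
    induction peels off the first vertex. *)
Lemma foldr_fmulE n (A : 'I_n -> J -> J -> F) j k :
  foldr fmul fone [seq A y | y <- enum 'I_n] j k =
  \sum_(f : {ffun 'I_n.+1 -> J} | (f ord0 == j) && (f ord_max == k))
     \prod_y A y (f (widen_ord (leqnSn n) y)) (f (lift ord0 y)).
Proof.
elim: n A j k => [|n IH] A j k.
  rewrite enum_ord0 /= /fone big_mkcond (sum_ffunS (n := 0)) (bigD1 j) //=.
  rewrite [X in _ + X]big1 ?addr0 => [|l /negPf lj].
    rewrite (big_pred1 [ffun=> j]) => [|f]; last by apply/esym/eqP/ffunP => -[].
    rewrite !fcons0 // eqxx /=.
    by case: (j == k); rewrite // big_ord0.
  by rewrite big1 // => f _; rewrite fcons0 // lj.
rewrite enum_ordSl /= /fmul -map_comp (eq_bigr (fun l => A ord0 j l *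
  \sum_(f : {ffun 'I_n.+1 -> J} | (f ord0 == l) && (f ord_max == k))
     \prod_y A (lift ord0 y) (f (widen_ord (leqnSn n) y)) (f (lift ord0 y)))); last first.
  by move=> l _; rewrite (IH (fun y => A (lift ord0 y))).
under eq_bigr => l _ do rewrite big_distrr big_mkcond /=.
rewrite exchange_big /= [RHS]big_mkcond (sum_ffunS (n := n.+1)) (bigD1 j) //=.
rewrite [X in _ = _ + X]big1 ?addr0; last first.
  by move=> l /negPf lj; rewrite big1 // => f _; rewrite fcons0 // lj.
apply: eq_bigr => f _.
have fmax : fcons j f ord_max = f ord_max.
  exact: fconsS.
rewrite fcons0 // eqxx fmax /=; case: (f ord_max == k); last first.
  by rewrite big1 // => l _; rewrite andbF.
(* The summation index [l] of the first product must be the start of the remaining path. *)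
rewrite (bigD1 (f ord0)) //= eqxx /= [X in _ + X]big1 ?addr0; last first.
  by move=> l /negPf; rewrite eq_sym => ->.
rewrite [RHS]big_ord_recl; congr (_ * _).
  by rewrite fcons0 // (fconsS _ _ (z := ord0)).
apply: eq_bigr => y _.
by rewrite (fconsS _ _ (z := widen_ord (leqnSn n) y)) ?(fconsS _ _ (z := lift ord0 y)).
Qed.

(** Equal ends close the path, which becomes a function on the cycle ['I_n]. For [n = 0] the two
    sides would be [#|J|] and 1. *)
Lemma trace_foldr_fmul n (A : 'I_n -> J -> J -> F) : (0 < n)%N ->
  \sum_j foldr fmul fone [seq A y | y <- enum 'I_n] j j =
  \sum_(f : {ffun 'I_n -> J}) \prod_y A y (f y) (f (ordS y)).
Proof.
case: n A => // n A _.
under eq_bigr => j _ do rewrite foldr_fmulE big_mkcond.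
rewrite exchange_big /=.
transitivity (\sum_(f : {ffun 'I_n.+2 -> J} | f ord_max == f ord0)
     \prod_y A y (f (widen_ord (leqnSn n.+1) y)) (f (lift ord0 y))).
  rewrite [RHS]big_mkcond; apply: eq_bigr => f _.
  rewrite (bigD1 (f ord0)) //= eqxx /= [X in _ + X]big1 ?addr0 // => j /negPf.
  by rewrite eq_sym => ->.
(* Reduction modulo [n.+1] sends the last vertex to the first, so composing with [wrap] opens a
   cycle into a path with equal ends. *)
pose wrap (y : 'I_n.+2) : 'I_n.+1 := inord (y %% n.+1).
have wrapE y : val (wrap y) = (y %% n.+1)%N by rewrite /wrap /= inordK // ltn_mod.
rewrite (reindex_onto (fun g : {ffun 'I_n.+1 -> J} => [ffun y => g (wrap y)])
  (fun f => [ffun y => f (widen_ord (leqnSn n.+1) y)])) /=; last first.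
  move=> f /eqP hf; apply/ffunP => y; rewrite !ffunE.
  case: (ltnP y n.+1) => [ly | ly].
    by congr (f _); apply: val_inj; rewrite /= wrapE modn_small.
  have ey : y = ord_max.
    by apply: val_inj => /=; apply/eqP; rewrite eqn_leq ly -ltnS ltn_ord.
  by rewrite ey hf; congr (f _); apply: val_inj; rewrite /= wrapE /= modnn.
apply: eq_big => [g | g _].
  rewrite !ffunE; apply/andP; split.
    by apply/eqP; congr (g _); apply: val_inj; rewrite !wrapE /= modnn mod0n.
  by apply/eqP/ffunP => y; rewrite !ffunE; congr (g _); apply: val_inj; rewrite wrapE /= modn_small.
apply: eq_bigr => y _; rewrite !ffunE.
by congr (A _ (g _) (g _)); apply: val_inj; rewrite wrapE //= modn_small.
Qed.

End MatrixProduct.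

(** * Sums of characters over products of cyclic groups *)

Section CharacterSum.
Variables (F : fieldType) (n : nat).

Lemma sum_expr_root_unity (z : F) : z ^+ n = 1 -> (0 < n)%N ->
  \sum_(k < n) z ^+ k = if z == 1 then n%:R else 0.
Proof.
move=> zn n0; case: eqVneq => [-> | z1].
  by rewrite (eq_bigr (fun=> 1)) => [|k _]; rewrite ?sumr_const ?card_ord ?expr1n.
apply: (mulfI (_ : z - 1 != 0)); first by rewrite subr_eq0.
by rewrite -subrX1 zn subrr mulr0.
Qed.

(** Reindexing the numerators by [s] gives factors [t y ^+ k (s y)] with [t y = z (s y) / z y]. The
    sum then splits into one geometric sum per [y], nonzero only when [t y = 1]. *)
Lemma sum_characters (Y : finType) (z : Y -> F) (s : Y -> Y) : injective s ->
  (0 < n)%N -> (forall y, z y != 0) -> (forall y, z y ^+ n = 1) ->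
  \sum_(k : {ffun Y -> 'I_n}) \prod_y (z y ^+ k y / z y ^+ k (s y)) =
  if [forall y, z (s y) == z y] then n%:R ^+ #|Y| else 0.
Proof.
move=> s_inj n0 z0 zn.
pose t y := z (s y) / z y.
have tn y : t y ^+ n = 1 by rewrite /t exprMn exprVn !zn divr1.
have -> : \sum_(k : {ffun Y -> 'I_n}) \prod_y (z y ^+ k y / z y ^+ k (s y)) =
          \sum_(k : {ffun Y -> 'I_n}) \prod_y t y ^+ k (s y).
  apply: eq_bigr => k _; rewrite big_split /= (reindex s) /=; last exact: onW_bij (injF_bij s_inj).
  by rewrite -big_split /=; apply: eq_bigr => y _; rewrite exprMn exprVn.
have -> : \sum_(k : {ffun Y -> 'I_n}) \prod_y t y ^+ k (s y) =
          \sum_(k : {ffun Y -> 'I_n}) \prod_y t y ^+ k y.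
  (* On a finite type [s] is bijective, so composing [k] with its inverse removes the shift. *)
  have [s' sK s'K] := injF_bij s_inj.
  rewrite (reindex (fun k : {ffun Y -> 'I_n} => [ffun y => k (s' y)])) /=; last first.
    exists (fun k : {ffun Y -> 'I_n} => [ffun y => k (s y)]) => k _;
    by apply/ffunP => y; rewrite !ffunE ?sK ?s'K.
  by apply: eq_bigr => k _; apply: eq_bigr => y _; rewrite ffunE sK.
rewrite -(bigA_distr_bigA (fun y (k : 'I_n) => t y ^+ k)) /=.
rewrite (eq_bigr (fun y => if t y == 1 then n%:R else 0)); last first.
  by move=> y _; rewrite sum_expr_root_unity.
have tE y : (t y == 1) = (z (s y) == z y) by rewrite /t -[1]divr1 eqr_div ?oner_eq0 // mulr1 mul1r.
case: ifP => [/forallP h | /negbT].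
  by rewrite (eq_bigr (fun=> n%:R)) ?prodr_const // => y _; rewrite tE h.
by case/forallPn => y; rewrite -tE => /negPf hy; rewrite (bigD1 y) //= hy mul0r.
Qed.

End CharacterSum.

(** * Arrays of the form i_x + a_y *)

Section Grids.
Variables (Z : finZmodType) (r p : nat).
Local Notation grid_type := {ffun 'I_r.+1 * 'I_p.+1 -> Z}.

(** Every index is reached from [ord0] by successors that do not wrap around. *)
Lemma ordS_invariant (T : Type) n (h : 'I_n.+1 -> T) :
  (forall y, h (ordS y) = h y) -> forall y, h y = h ord0.
Proof.
move=> hS [m]; elim: m => [|m IH] lt_m; first by congr h; apply: val_inj.
rewrite -(IH (ltnW lt_m)) -[RHS]hS; congr h; apply: val_inj => /=.
by rewrite modn_small.
Qed.

(** Vanishing of the mixed second differences, cyclically and without subtraction. *)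
Definition is_grid (f : grid_type) :=
  [forall x, forall y,
    f (x, y) + f (ordS x, ordS y) == f (x, ordS y) + f (ordS x, y)].

Definition outer_sum (i : {ffun 'I_r.+1 -> Z}) (a : {ffun 'I_p.+1 -> Z}) : grid_type :=
  [ffun u => i u.1 + a u.2].

Lemma is_grid_outer_sum i a : is_grid (outer_sum i a).
Proof.
apply/forallP => x; apply/forallP => y; rewrite !ffunE /=.
by rewrite addrACA [X in _ + X]addrC addrACA.
Qed.

(** Differences of consecutive rows are constant in [y]; hence [f (x, y) - f (x, ord0)] is constant
    in [x]. *)
Lemma is_gridP (f : grid_type) : is_grid f ->
  forall x y, f (x, y) = f (x, ord0) - f (ord0, ord0) + f (ord0, y).
Proof.
move=> /forallP hf x y.
have h1 x' : f (x', y) - f (ordS x', y) = f (x', ord0) - f (ordS x', ord0).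
  apply: (@ordS_invariant _ _ (fun y => f (x', y) - f (ordS x', y))) => {}y.
  have /forallP/(_ y)/eqP h := hf x'.
  apply/eqP; rewrite subr_eq addrAC eq_sym subr_eq; apply/eqP.
  by rewrite h.
have h2 : f (x, y) - f (x, ord0) = f (ord0, y) - f (ord0, ord0).
  apply: (@ordS_invariant _ _ (fun x => f (x, y) - f (x, ord0))) => {}x.
  apply/eqP; rewrite subr_eq addrAC eq_sym subr_eq; apply/eqP.
  have /eqP := h1 x; rewrite subr_eq addrAC eq_sym subr_eq => /eqP h.
  by rewrite -h addrC.
by rewrite -addrA [X in _ + X]addrC -h2 addrC subrK.
Qed.

Lemma sum_outer_sum (V : nmodType) (g : grid_type -> V) :
  \sum_i \sum_a g (outer_sum i a) = (\sum_(f | is_grid f) g f) *+ #|Z|.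
Proof.
rewrite -sumr_const [RHS](_ : _ =
   \sum_(u : Z * grid_type | is_grid u.2) g u.2); last first.
  by rewrite -(pair_big xpredT is_grid (fun _ f => g f)).
(* The only freedom in a representation is a constant moved between [i] and [a]; the extra index in
   [Z] records it as the value of [i] at [ord0]. *)
rewrite pair_big /= [RHS](reindex_onto
  (fun u : {ffun 'I_r.+1 -> Z} * {ffun 'I_p.+1 -> Z} => (u.1 ord0, outer_sum u.1 u.2))
  (fun u => ([ffun x => u.2 (x, ord0) - u.2 (ord0, ord0) + u.1],
             [ffun y => u.2 (ord0, y) - u.1]))) /=.
  apply: eq_bigl => -[i a]; rewrite is_grid_outer_sum /=; apply/esym/eqP.
  congr pair; apply/ffunP => x; rewrite !ffunE /=.
    by rewrite opprD addrACA subrr addr0 subrK.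
  by rewrite addrAC subrr add0r.
move=> [t f] /= hf; congr pair; first by rewrite ffunE subrr add0r.
apply/ffunP => -[x y]; rewrite !ffunE /= (is_gridP hf x y).
by rewrite -!addrA; congr (_ + (_ + _)); rewrite addrCA subrr addr0.
Qed.

End Grids.

End Algebra.

(** * Transfer of matrix operations to [R[i]] *)

Section ComplexMatrices.
Local Open Scope ring_scope.
Variable J : finType.
Implicit Type A : cmat J.

Definition toF_mx A : J -> J -> R[i] := fun j k => toF (A j k).

Lemma toF_cmat1 j k : toF_mx (@cmat1 J) j k = fone _ j k.
Proof. by rewrite /toF_mx /cmat1 /fone; case: eqP. Qed.

Lemma toF_cmatmul A B j k : toF_mx (cmatmul A B) j k = fmul (toF_mx A) (toF_mx B) j k.
Proof. by rewrite /toF_mx /cmatmul toF_sum. Qed.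

Lemma toF_ctrace A : toF (ctrace A) = \sum_j toF_mx A j j.
Proof. by rewrite /ctrace toF_sum. Qed.

Lemma toF_cmatprod s j k :
  toF_mx (cmatprod s) j k = foldr (@fmul _ J) (@fone _ J) [seq toF_mx A | A <- s] j k.
Proof.
elim: s j k => [|A s IH] j k /=; first exact: toF_cmat1.
by rewrite toF_cmatmul; apply: eq_bigr => l _; rewrite IH.
Qed.

Lemma toF_cmatpow A n j k :
  toF_mx (cmatpow A n) j k =
  foldr (@fmul _ J) (@fone _ J) [seq toF_mx A | y <- enum 'I_n] j k.
Proof.
have -> : [seq toF_mx A | _ <- enum 'I_n] = nseq n (toF_mx A).
  by rewrite -[in RHS](size_enum_ord n); elim: (enum _) => //= y s ->.
elim: n j k => [|n IH] j k; first exact: toF_cmat1.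
rewrite -addn1 nseqD cats1 foldr_fmul_rcons addn1 /cmatpow iterS.
by rewrite toF_cmatmul; apply: eq_bigr => l _; rewrite -IH.
Qed.

End ComplexMatrices.

(** * Entries of T_p as sums over balanced paths *)

Section Integrand.
Local Open Scope ring_scope.

Lemma toF_Cinv z : toF (Cinv z) = (toF z)^-1.
Proof.
case: z => a b; rewrite /toF /Cinv /=.
congr Complex; rewrite RdivE //.
exact: mulNr.
Qed.

(** Conjugation is inversion on the unit circle, which makes the entries of the projections
    quotients of entries of xi. *)
Lemma toF_conj_unit z t : toF z = e t -> toF (Cconj z) = (toF z)^-1.
Proof.
move=> h; have -> : z = Cexp2pi t by apply: toF_inj.
by rewrite toF_conj_e eN.
Qed.

Lemma toF_wpow k a b : (0 < k)%N -> toF (wpow k a b) = e (1 / INR k) ^+ (a * b).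
Proof.
move=> k0; rewrite -eMn -mulr_natl -INRE -RmultE -/(e _); congr e.
have : INR k <> 0%coqR by apply: not_0_INR; case: k k0.
by rewrite /Rdiv => k0'; rewrite -!RdivE -R1E; field.
Qed.

Lemma sum_count_mem (K : pzRingType) (V : finType) (s : seq V) (th : V -> K) :
  \sum_k (count_mem k s)%:R * th k = \sum_(k <- s) th k.
Proof.
elim: s => [|x s IH]; first by rewrite big_nil big1 // => k _; rewrite mul0r.
rewrite big_cons -IH [RHS](_ : _ = \sum_k ((x == k)%:R + (count_mem k s)%:R) * th k).
  by apply: eq_bigr => k _; rewrite /= natrD.
under [RHS]eq_bigr => k _ do rewrite mulrDl.
rewrite big_split /=; congr (_ + _).
rewrite (bigD1 x) //= eqxx mul1r big1 ?addr0 // => k /negPf.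
by rewrite eq_sym => ->; rewrite mul0r.
Qed.

Variables (m n p : nat).
Local Notation M := m.+1.
Local Notation N := n.+1.
Local Notation u := (e (1 / INR M)).
Local Notation v := (e (1 / INR N)).

(** The part of an entry of xi that does not depend on Q. *)
Definition phase (al be ga : Idx M N) : R[i] :=
  (u ^+ al.1 / u ^+ be.1) ^+ ga.1 * (v ^+ al.2 / v ^+ be.2) ^+ ga.2.

Lemma toF_xi th (al be ga : Idx M N) :
  toF (xi th al be ga) = e (th (al.1, ga.2) - th (be.1, ga.2)) * phase al be ga.
Proof.
rewrite /xi toF_mul toF_Cinv /Hmat !toF_mul !toF_wpow //.
rewrite !invfM mulrACA [X in _ * X]mulrACA eD eN /phase !exprMn !exprVn -!exprM.
by [].
Qed.

Lemma toF_conj_xi th (al be ga : Idx M N) :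
  toF (Cconj (xi th al be ga)) = (toF (xi th al be ga))^-1.
Proof.
pose t := th (al.1, ga.2) - th (be.1, ga.2) +
  ((1 / INR M *+ al.1 - 1 / INR M *+ be.1) *+ ga.1 +
   (1 / INR N *+ al.2 - 1 / INR N *+ be.2) *+ ga.2).
apply: (@toF_conj_unit _ t).
by rewrite toF_xi /phase /t !(eD, eN, eMn).
Qed.

Lemma subr_subr (V : zmodType) (a b c d : V) : (a - b) - (c - d) = (a + d) - (c + b).
Proof. by rewrite !opprD opprK addrACA [RHS]addrACA [- b + d]addrC [d - b]addrC. Qed.

Definition pairs (i j : 'I_p -> 'I_M) (c c' : 'I_p -> 'I_N) : seq (Idx M N) :=
  flatten [seq [:: (i y, c y); (j y, c' y)] | y <- enum 'I_p].

(** The row indices [i] and [j] are arbitrary, so that the notion covers both the entries of T_p and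
    the conditions (E_x). *)
Definition balanced (i j : 'I_p -> 'I_M) (c : 'I_p -> 'I_N) : bool :=
  perm_eq (pairs i j c (fun y => c (ordS y))) (pairs i j (fun y => c (ordS y)) c).

Lemma sum_pairs (K : nmodType) (th : Idx M N -> K) i j c c' :
  \sum_(k <- pairs i j c c') th k = \sum_y (th (i y, c y) + th (j y, c' y)).
Proof.
rewrite /pairs big_flatten big_map big_enum /=; apply: eq_bigr => y _.
by rewrite !big_cons big_nil addr0.
Qed.

(** Grouping the angles by their index makes the multiplicity differences the exponents of a
    monomial in Q. *)
Lemma sum_pairs_sub (K : pzRingType) (th : Idx M N -> K) i j c c' :
  \sum_y ((th (i y, c y) + th (j y, c' y)) - (th (i y, c' y) + th (j y, c y))) =
  \sum_k ((count_mem k (pairs i j c c'))%:Z - (count_mem k (pairs i j c' c))%:Z)%:~R * th k.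
Proof.
transitivity (\sum_(k <- pairs i j c c') th k - \sum_(k <- pairs i j c' c) th k).
  by rewrite !sum_pairs sumrB.
rewrite -(sum_count_mem (pairs i j c c')) -(sum_count_mem (pairs i j c' c)) -sumrB.
by apply: eq_bigr => k _; rewrite rmorphB /= mulrBl.
Qed.

(** One factor 1/K comes from each of the [p] projections and one from the normalised trace, whence
    the exponent [p.+1]. *)
Definition weight (al be ga : Tidx M N p) : R[i] :=
  (M * N)%:R^-1 ^+ p.+1 *
  \prod_y (phase (al y) (be y) (ga y) / phase (al y) (be y) (ga (ordS y))).

Lemma toF_Kinv : toF (CofR (Rinv (Kdim M N))) = (M * N)%:R^-1.
Proof. by rewrite /Kdim -mult_INR toF_nat_inv. Qed.

Definition freq (al be ga : Tidx M N p) (k : Idx M N) : int :=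
  (count_mem k (pairs (fun y => (al y).1) (fun y => (be y).1)
     (fun y => (ga y).2) (fun y => (ga (ordS y)).2)))%:Z -
  (count_mem k (pairs (fun y => (al y).1) (fun y => (be y).1)
     (fun y => (ga (ordS y)).2) (fun y => (ga y).2)))%:Z.

Lemma toF_Tintegrand (al be : Tidx M N p) th : (0 < p)%N ->
  toF (Tintegrand al be th) =
  \sum_ga weight al be ga * trig_mono (freq al be ga) th.
Proof.
move=> p0.
rewrite /Tintegrand toF_mul toF_Kinv toF_ctrace.
under eq_bigr => j _ do rewrite toF_cmatprod -map_comp.
rewrite (trace_foldr_fmul (fun y => toF_mx (Umat th (al y) (be y)))) // mulr_sumr.
apply: eq_bigr => ga _.
rewrite (eq_bigr (fun y => (M * N)%:R^-1 * (
   e ((th ((al y).1, (ga y).2) + th ((be y).1, (ga (ordS y)).2)) -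
      (th ((al y).1, (ga (ordS y)).2) + th ((be y).1, (ga y).2))) *
   (phase (al y) (be y) (ga y) / phase (al y) (be y) (ga (ordS y)))))); last first.
  move=> y _; rewrite /toF_mx /Umat (toF_mul (CofR _)) (toF_mul (xi _ _ _ _)) toF_Kinv toF_conj_xi !toF_xi.
  rewrite invfM mulrACA -eN -eD; congr (_ * (e _ * _)).
  exact: subr_subr.
rewrite big_split prodr_const card_ord /= mulrA -exprS /weight -mulrA.
congr (_ * _); rewrite big_split /= mulrC; congr (_ * _).
rewrite -e_sum /trig_mono; congr e.
exact: (@sum_pairs_sub R th (fun y => (al y).1) (fun y => (be y).1)
  (fun y => (ga y).2) (fun y => (ga (ordS y)).2)).
Qed.

Lemma freq_eq0 (al be ga : Tidx M N p) :
  [forall k, freq al be ga k == 0] =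
  balanced (fun y => (al y).1) (fun y => (be y).1) (fun y => (ga y).2).
Proof.
apply/forallP/permP => [h | h k].
  apply/permP; rewrite /perm_eq; apply/allP => k _ /=.
  by have := h k; rewrite /freq subr_eq0 => /eqP [->].
by rewrite /freq subr_eq0 h.
Qed.

Lemma is_Tp_entry (T : cmat (Tidx M N p)) (al be : Tidx M N p) :
  (0 < p)%N -> is_Tp T ->
  toF (T al be) =
  \sum_(ga : Tidx M N p |
     balanced (fun y => (al y).1) (fun y => (be y).1) (fun y => (ga y).2))
   weight al be ga.
Proof.
move=> p0 hT.
rewrite (haar_int_trig_poly (fun th => toF_Tintegrand al be th p0) (hT al be)).
by apply: eq_bigl => ga; rewrite freq_eq0.
Qed.

End Integrand.

(** * Moments as sums over pairs of grids, and their count *)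

Section Moments.
Local Open Scope ring_scope.
Variables (m n p r : nat).
Local Notation M := m.+1.
Local Notation N := n.+1.
Local Notation u := (e (1 / INR M)).
Local Notation v := (e (1 / INR N)).

Lemma sum_ffun_pair (V : nmodType) (A : finType) (F : {ffun A -> Idx M N} -> V) :
  \sum_f F f =
  \sum_(k : {ffun A -> 'I_M}) \sum_(c : {ffun A -> 'I_N}) F [ffun y => (k y, c y)].
Proof.
rewrite pair_big /=.
rewrite (reindex (fun w : {ffun A -> 'I_M} * {ffun A -> 'I_N} =>
   [ffun y => (w.1 y, w.2 y)] : {ffun A -> Idx M N})) //=.
exists (fun f : {ffun A -> Idx M N} => ([ffun y => (f y).1], [ffun y => (f y).2])).
  by move=> [k c] _; congr pair; apply/ffunP => y; rewrite !ffunE.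
by move=> f _; apply/ffunP => y; rewrite !ffunE; case: (f y).
Qed.

Lemma sum_ffun_curry (V : nmodType) (A B X : finType) (F : {ffun A -> {ffun B -> X}} -> V) :
  \sum_f F f = \sum_(g : {ffun A * B -> X}) F [ffun x => [ffun y => g (x, y)]].
Proof.
rewrite (reindex (fun g : {ffun A * B -> X} => [ffun x => [ffun y => g (x, y)]])) //=.
exists (fun f : {ffun A -> {ffun B -> X}} => [ffun w => f w.1 w.2]).
  by move=> g _; apply/ffunP => -[x y]; rewrite !ffunE.
by move=> f _; apply/ffunP => x; apply/ffunP => y; rewrite !ffunE.
Qed.

(** After cross-multiplication, powers of a primitive root agree exactly when the exponents agree
    modulo [k.+1], that is, in the group ['I_k.+1]. *)
Lemma prim_ratio_eq k (w : R[i]) (a b c d : 'I_k.+1) : k.+1.-primitive_root w ->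
  (w ^+ a / w ^+ b == w ^+ c / w ^+ d) = (a + d == c + b).
Proof.
move=> pw.
have w0 (x : nat) : w ^+ x != 0 by rewrite expf_neq0 // (prim_root_eq0 pw).
by rewrite eqr_div // -!exprD (eq_prim_root_expr pw).
Qed.

Lemma exp_ratio_root k (w : R[i]) (a b : nat) : k.-primitive_root w ->
  (w ^+ a / w ^+ b) ^+ k = 1.
Proof.
move=> pw; rewrite exprMn exprVn -!exprM mulnC [(b * _)%N]mulnC !exprM.
by rewrite (prim_expr_order pw) !expr1n divr1.
Qed.

Definition parallel (i j : 'I_p.+1 -> 'I_M) : bool :=
  [forall y, i y + j (ordS y) == i (ordS y) + j y].

Definition vphase (a b : 'I_p.+1 -> 'I_N) (c : 'I_p.+1 -> 'I_N) : R[i] :=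
  \prod_y ((v ^+ a y / v ^+ b y) ^+ c y / (v ^+ a y / v ^+ b y) ^+ c (ordS y)).

Lemma ordS_inj k : injective (@ordS k).
Proof. exact: bij_inj (ordS_bij k). Qed.

(** The sum over the Z_M-components of [ga] is a character sum; it gives [M%:R ^+ p.+1] when the row
    indices are parallel and 0 otherwise. *)
Lemma sum_weight (al be : Tidx M N p.+1) :
  \sum_(ga : Tidx M N p.+1 |
     balanced (fun y => (al y).1) (fun y => (be y).1) (fun y => (ga y).2))
   weight al be ga =
  \sum_(c : {ffun 'I_p.+1 -> 'I_N})
   (M * N)%:R^-1 ^+ p.+2 * M%:R ^+ p.+1 *
   (parallel (fun y => (al y).1) (fun y => (be y).1) &&
    balanced (fun y => (al y).1) (fun y => (be y).1) c)%:R *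
   vphase (fun y => (al y).2) (fun y => (be y).2) c.
Proof.
have pu : M.-primitive_root u by apply: prim_root_e.
have u0 (x : nat) : u ^+ x != 0 by rewrite expf_neq0 // e_neq0.
rewrite big_mkcond (sum_ffun_pair (A := 'I_p.+1)) exchange_big /=; apply: eq_bigr => c _.
(* Balance reads only the Z_N-components of [ga], so it is constant in the sum over [k]. *)
under eq_bigr => k _.
  have -> : balanced (fun y => (al y).1) (fun y => (be y).1)
     (fun y => ([ffun y => (k y, c y)] y).2) =
    balanced (fun y => (al y).1) (fun y => (be y).1) c.
    rewrite /balanced /pairs; congr perm_eq; congr flatten; apply: eq_map => y; by rewrite !ffunE.
  over.
case: (balanced _ _ _); last by rewrite big1 // andbF mulr0 mul0r.
rewrite andbT.
pose z y := u ^+ (al y).1 / u ^+ (be y).1.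
have hw (k : {ffun 'I_p.+1 -> 'I_M}) : weight al be [ffun y => (k y, c y)] =
  (M * N)%:R^-1 ^+ p.+2 * vphase (fun y => (al y).2) (fun y => (be y).2) c *
   \prod_y (z y ^+ k y / z y ^+ k (ordS y)).
  rewrite /weight -mulrA; congr (_ * _); rewrite /vphase -big_split /=.
  apply: eq_bigr => y _; rewrite /phase !ffunE /= invfM mulrACA mulrC; done.
rewrite (eq_bigr _ (fun k _ => hw k)) -mulr_sumr sum_characters //; last first.
- by move=> y; apply: exp_ratio_root.
- by move=> y; rewrite mulf_neq0 ?invr_eq0.
- exact: ordS_inj.
have -> : [forall y, z (ordS y) == z y] = parallel (fun y => (al y).1) (fun y => (be y).1).
  by apply: eq_forallb => y; rewrite prim_ratio_eq // eq_sym.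
rewrite card_ord; case: parallel; first by rewrite mulr1 mulrAC.
by rewrite !mulr0 mul0r.
Qed.

Lemma prod_natb (K : comNzRingType) (X : finType) (b : X -> bool) :
  \prod_x (b x)%:R = [forall x, b x]%:R :> K.
Proof.
case: (boolP [forall x, b x]) => [/forallP h | /forallPn [x /negPf h]].
  by rewrite big1 // => x _; rewrite h.
by rewrite (bigD1 x) //= h mul0r.
Qed.

Lemma forallb_and (X : finType) (A B : pred X) :
  [forall x, A x && B x] = [forall x, A x] && [forall x, B x].
Proof.
apply/forallP/andP => [h | [/forallP hA /forallP hB] x]; last by rewrite hA hB.
by split; apply/forallP => x; case/andP: (h x).
Qed.

Local Notation row f x := (fun y => f (x, y)).

Definition all_balanced (i : {ffun 'I_r.+1 * 'I_p.+1 -> 'I_M})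
    (c : {ffun 'I_r.+1 * 'I_p.+1 -> 'I_N}) : bool :=
  [forall x, balanced (row i x) (row i (ordS x)) (row c x)].

Lemma is_grid_parallel (i : {ffun 'I_r.+1 * 'I_p.+1 -> 'I_M}) :
  is_grid i = [forall x, parallel (row i x) (row i (ordS x))].
Proof. by []. Qed.

(* Exchanging the roles of base and exponent, [v ^ (a c)] seen as a character in [a]. *)
Lemma sum_vphase (c : {ffun 'I_r.+1 * 'I_p.+1 -> 'I_N}) :
  \sum_(a : {ffun 'I_r.+1 * 'I_p.+1 -> 'I_N})
     \prod_x vphase (row a x) (row a (ordS x)) (row c x) =
  if is_grid c then N%:R ^+ (r.+1 * p.+1) else 0.
Proof.
have pv : N.-primitive_root v by apply: prim_root_e.
pose D (w : 'I_r.+1 * 'I_p.+1) := v ^+ c w / v ^+ c (w.1, ordS w.2).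
pose s (w : 'I_r.+1 * 'I_p.+1) := (ordS w.1, w.2).
transitivity (\sum_(a : {ffun 'I_r.+1 * 'I_p.+1 -> 'I_N})
   \prod_w (D w ^+ a w / D w ^+ a (s w))).
  apply: eq_bigr => a _; rewrite /vphase pair_big /=; apply: eq_bigr => -[x y] _.
  rewrite /D /s /= !exprMn !exprVn -!exprM !invfM mulrACA.
  by rewrite !(mulnC (c _)).
rewrite sum_characters //.
- rewrite card_prod !card_ord; congr (if _ then _ else _).
  apply/forallP/forallP => [h x | h [x y]].
    apply/forallP => y; have := h (x, y).
    by rewrite prim_ratio_eq //= eq_sym [X in _ == X]addrC.
  have /forallP/(_ y) := h x.
  by rewrite prim_ratio_eq //= eq_sym [X in X == _]addrC.
- move=> [x y] [x' y'] h; congr pair; last exact: (congr1 snd h).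
  exact: ordS_inj (congr1 fst h).
- by move=> w; rewrite mulf_neq0 ?invr_eq0 // expf_neq0 // e_neq0.
- by move=> w; apply: exp_ratio_root.
Qed.

(** The trace runs over cyclic sequences of row indices. Parallelism of consecutive rows makes [i] a
    grid, and the sum over [a] makes [c] one. *)
Lemma moment_grids (T : cmat (Tidx M N p.+1)) : is_Tp T ->
  toF (ctrace (cmatpow T r.+1)) =
  ((M * N)%:R^-1 ^+ p.+2 * M%:R ^+ p.+1) ^+ r.+1 * N%:R ^+ (r.+1 * p.+1) *
  \sum_(i | is_grid i) \sum_(c | is_grid c) (all_balanced i c)%:R.
Proof.
move=> hT; rewrite toF_ctrace.
under eq_bigr => j _ do rewrite toF_cmatpow.
rewrite (trace_foldr_fmul (fun _ : 'I_r.+1 => toF_mx T)) //.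
set C := _ * M%:R ^+ p.+1.
pose G (al be : Tidx M N p.+1) (c : {ffun 'I_p.+1 -> 'I_N}) : R[i] := C *
   (parallel (fun y => (al y).1) (fun y => (be y).1) &&
    balanced (fun y => (al y).1) (fun y => (be y).1) c)%:R *
   vphase (fun y => (al y).2) (fun y => (be y).2) c.
have hG al be : toF_mx T al be = \sum_c G al be c.
  by rewrite /toF_mx (is_Tp_entry al be _ hT) // sum_weight.
transitivity (\sum_(f : {ffun 'I_r.+1 -> Tidx M N p.+1})
   \sum_(c : {ffun 'I_r.+1 -> {ffun 'I_p.+1 -> 'I_N}})
     \prod_x G (f x) (f (ordS x)) (c x)).
  apply: eq_bigr => f _; rewrite -(bigA_distr_bigA (fun x c => G (f x) (f (ordS x)) c)).
  by apply: eq_bigr => x _; rewrite hG.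
(* The sequence of multi-indices becomes a two-dimensional array, split into its Z_M-part [i] and
   its Z_N-part [a]. *)
rewrite sum_ffun_curry sum_ffun_pair.
transitivity (\sum_(i : {ffun 'I_r.+1 * 'I_p.+1 -> 'I_M})
  \sum_(a : {ffun 'I_r.+1 * 'I_p.+1 -> 'I_N})
  \sum_(c : {ffun 'I_r.+1 * 'I_p.+1 -> 'I_N})
    (C ^+ r.+1 * (is_grid i && all_balanced i c)%:R *
      \prod_x vphase (row a x) (row a (ordS x)) (row c x))).
  apply: eq_bigr => i _; apply: eq_bigr => a _; rewrite sum_ffun_curry.
  apply: eq_bigr => c _.
  rewrite is_grid_parallel -forallb_and -prod_natb -[in C ^+ _](card_ord r.+1) -prodr_const -!big_split /=.
  apply: eq_bigr => x _; rewrite /G; set f := [ffun x => _].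
  have fE x' y : f x' y = (i (x', y), a (x', y)) by rewrite !ffunE.
  have f1 x' : (fun y => (f x' y).1) = row i x'.
    by apply: functional_extensionality => y; rewrite fE.
  have f2 x' : (fun y => (f x' y).2) = row a x'.
    by apply: functional_extensionality => y; rewrite fE.
  have -> : [ffun x => [ffun y => c (x, y)]] x = row c x :> (_ -> _).
    by apply: functional_extensionality => y; rewrite !ffunE.
  by rewrite !f1 !f2.
rewrite [in RHS]big_mkcond mulr_sumr; apply: eq_bigr => i _.
(* The sum over [a] moves inside, where only the phases depend on it. *)
rewrite exchange_big /= [in RHS]big_mkcond.
case: (is_grid i); last first.
  by rewrite [RHS]mulr0 big1 // => c _; rewrite big1 // => a _; rewrite mulr0 mul0r.
rewrite mulr_sumr; apply: eq_bigr => c _; rewrite -mulr_sumr sum_vphase.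
by case: (is_grid c); rewrite ?mulr0 // mulrAC.
Qed.

Lemma pairs_translate (d : 'I_N) (i j : 'I_p.+1 -> 'I_M) (c c' : 'I_p.+1 -> 'I_N) :
  pairs i j (fun y => d + c y) (fun y => d + c' y) =
  [seq (w.1, d + w.2) | w <- pairs i j c c'].
Proof. by rewrite /pairs map_flatten -[in RHS]map_comp. Qed.

(** Both multisets are moved by the same injective map, so their equality is preserved and
    reflected. *)
Lemma balanced_translate (d : 'I_N) (i j : 'I_p.+1 -> 'I_M) (c : 'I_p.+1 -> 'I_N) :
  balanced i j (fun y => d + c y) = balanced i j c.
Proof.
have tr_inj : injective (fun w : Idx M N => (w.1, d + w.2)).
  move=> [x y] [x' y'] h; congr pair; first exact: (congr1 fst h).
  exact: addrI (congr1 snd h).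
rewrite /balanced !pairs_translate; apply/idP/idP; last exact: perm_map.
exact: (perm_map_inj tr_inj).
Qed.

Lemma addZE k (x y : 'I_k.+1) : addZ x y = x + y.
Proof. exact: val_inj. Qed.

Lemma cond_E_balanced (i : {ffun 'I_r.+1 -> 'I_M}) (a : {ffun 'I_p.+1 -> 'I_M})
    (b : {ffun 'I_p.+1 -> 'I_N}) x :
  cond_E i a b x = balanced (fun y => i x + a y) (fun y => i (ordS x) + a y) b.
Proof.
by rewrite /cond_E /balanced /pairs; congr perm_eq; congr flatten; apply: eq_map => y;
  rewrite !addZE.
Qed.

Lemma all_balanced_outer_sum i (a : {ffun 'I_p.+1 -> 'I_M}) d b :
  all_balanced (outer_sum i a) (outer_sum d b) = [forall x, cond_E i a b x].
Proof.
apply: eq_forallb => x; rewrite cond_E_balanced -[RHS](balanced_translate (d x)).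
by congr balanced; apply: functional_extensionality => y; rewrite ffunE.
Qed.

(** The factors M and N count the representations of [i] and of [c] as outer sums. The power of N
    counts the row offsets [d] of [c], on which balance does not depend. *)
Lemma sum_grids_count :
  (M * N)%:R * \sum_(i | is_grid i) \sum_(c | is_grid c) (all_balanced i c)%:R =
  N%:R ^+ r.+1 * (count_E M N p.+1 r.+1)%:R :> R[i].
Proof.
rewrite natrM -mulrA mulr_sumr mulr_natl.
rewrite -{1}(card_ord M) -sum_outer_sum.
under eq_bigr => i _ do under eq_bigr => a _ do
  rewrite mulr_natl -[in X in _ *+ X](card_ord N) -sum_outer_sum exchange_big.
transitivity (\sum_(i : {ffun 'I_r.+1 -> 'I_M}) \sum_(a : {ffun 'I_p.+1 -> 'I_M})
  \sum_(b : {ffun 'I_p.+1 -> 'I_N}) N%:R ^+ r.+1 * [forall x, cond_E i a b x]%:R : R[i]).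
  apply: eq_bigr => i _; apply: eq_bigr => a _; apply: eq_bigr => b _.
  under eq_bigr => d _ do rewrite all_balanced_outer_sum.
  by rewrite sumr_const card_ffun !card_ord -[LHS]mulr_natl natrX.
rewrite /count_E -sum1_card natr_sum [in RHS]big_mkcond /= mulr_sumr !pair_big /=.
by apply: eq_bigr => -[[i a] b] _; rewrite inE /=; case: [forall x, _].
Qed.

End Moments.

(** * Collecting the powers of M and N, and the moment formula *)

Lemma moment_constant (K : fieldType) (a b k : K) (p r : nat) : a != 0%R -> b != 0%R ->
  (((a * b)^-1 ^+ p.+1 * a ^+ p) ^+ r * b ^+ (r * p) * (b ^+ r * k) =
   a * b * (k / (a ^+ (r + 1) * b)))%R.
Proof.
move=> a0 b0.
have ab0 : (a * b != 0)%R by rewrite mulf_neq0.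
(* Each of the [r] factors keeps a single inverse of [a]; its [p.+1] inverses of [b] cancel against
   [b ^+ (r * p)] and [b ^+ r]. *)
have -> : ((a * b)^-1 ^+ p.+1 * a ^+ p = a^-1 * b^-1 ^+ p.+1)%R.
  by rewrite invfM exprMn mulrAC exprS -(mulrA a^-1%R) -exprMn mulVf // expr1n mulr1.
rewrite [LHS]mulrA -(mulrA _ _ (b ^+ r)%R) -exprD -mulnSr mulnC exprM -exprMn -(mulrA a^-1%R).
rewrite -exprMn mulVf // expr1n mulr1 exprVn addn1 exprSr.
by rewrite -[(a ^+ r * a * b)%R]mulrA invfM mulrCA [X in _ = (_ * X)%R]mulrCA
  mulfV // mulr1 mulrC.
Qed.

Theorem theorem2p2 (M N p r : nat) (hM : (1 <= M)%N) (hN : (1 <= N)%N)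
  (hp : (1 <= p)%N) (hr : (1 <= r)%N) (T : cmat (Tidx M N p)) :
  is_Tp T ->
  ctrace (cmatpow T r) =
  CofR (Rdiv (INR (count_E M N p r))
             (Rmult (pow (INR M) (r + 1)) (INR N))).
Proof.
(* Successor form gives the index ordinals their additive group structure and a base point
   [ord0]. *)
case: M hM T => // m _; case: N hN => // n _; case: p hp => // p _; case: r hr => // r _ T hT.
apply: toF_inj; rewrite (moment_grids _ hT).
have hR : toF (CofR (Rdiv (INR (count_E m.+1 n.+1 p.+1 r.+1))
             (Rmult (pow (INR m.+1) (r.+1 + 1)) (INR n.+1)))) =
  ((count_E m.+1 n.+1 p.+1 r.+1)%:R / (m.+1%:R ^+ (r.+1 + 1) * n.+1%:R))%R.
  rewrite RdivE RmultE RpowE !INRE /toF /CofR /=.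
  rewrite -[LHS]/(real_complex R _) rmorphM fmorphV rmorphM rmorphXn !rmorph_nat.
  by [].
rewrite hR.
have nat_neq0 k : (k.+1%:R != 0 :> R[i])%R.
  by rewrite -(rmorph_nat (real_complex R)) fmorph_eq0 Num.Theory.pnatr_eq0.
have M0 := nat_neq0 m; have N0 := nat_neq0 n.
have hc := sum_grids_count m n p r.
have MN0 : ((m.+1 * n.+1)%:R != 0 :> R[i])%R by rewrite natrM mulf_neq0.
(* The grid sum is known only after multiplication by MN, so both sides are multiplied by it. *)
apply: (mulfI MN0); rewrite mulrCA hc natrM.
exact: moment_constant.
Qed.
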